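(* There exist a free group $F$ and normal subgroups $R$, $S$ of $F$ such that the quotient $$\frac{F\cap (1+\mathfrak r\mathfrak f\mathfrak s)}{[R'\cap S',\, R\cap S]\,[R'\cap S,\,R'\cap S]\,[R\cap S',\, R\cap S']}$$ is non-trivial.
   Context: For a normal subgroup $G$ of $F$, $\mathfrak g$ denotes the two-sided ideal of the integral group ring $\mathbb Z[F]$ generated by $G-1=\{g-1 : g\in G\}$; thus $\mathfrak r,\mathfrak f,\mathfrak s$ are the ideals corresponding to $R,F,S$ (so $\mathfrak f$ is the augmentation ideal), and $\mathfrak r\mathfrak f\mathfrak s$ is their product. For a two-sided ideal $\mathfrak a$ of $\mathbb Z[F]$, $F\cap(1+\mathfrak a)=\{w\in F : w-1\in\mathfrak a\}$, a normal subgroup of $F$. $R'=[R,R]$ and $S'=[S,S]$ are the derived subgroups. For subgroups $A,B$ of $F$, $[A,B]$ is the subgroup generated by all commutators $[a,b]=a^{-1}b^{-1}ab$, $a\in A$, $b\in B$. The denominator is a normal subgroup of $F$ contained in $F\cap(1+\mathfrak r\mathfrak f\mathfrak s)$. *)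

(* Defs.v *)
From HB Require Import structures.
From mathcomp Require Import all_boot all_algebra finmap.
From mathcomp.multinomials Require Import monalg.
From mathcomp.classical Require Import classical_sets.

Set Implicit Arguments.
Unset Strict Implicit.
Unset Printing Implicit Defensive.

Import GRing.Theory.
Local Open Scope ring_scope.
Local Open Scope classical_set_scope.

Definition is_free_on (X : Type) (F : groupType) (i : X -> F) : Prop :=
  forall (G : groupType) (f : X -> G),
    exists phi : F -> G,
      [/\ monoid.monoid_morphism phi, forall x, phi (i x) = f x &
          forall psi : F -> G, monoid.monoid_morphism psi ->
            (forall x, psi (i x) = f x) -> psi =1 phi].

Definition is_free (F : groupType) : Prop :=
  exists (X : Type) (i : X -> F), is_free_on i.

Record is_subgroup (G : groupType) (H : set G) : Prop := IsSubgroup {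
  subgroup1 : H 1%g;
  subgroupM : forall x y, H x -> H y -> H (x * y)%g;
  subgroupV : forall x, H x -> H (x^-1)%g }.

Record is_normal (G : groupType) (H : set G) : Prop := IsNormal {
  normal_subgroup : is_subgroup H;
  normalJ : forall x y, H x -> H (x ^ y)%g }.

(* MathComp's [[~ a, b]] is a^-1 * b^-1 * a * b. *)
Definition commutator (G : groupType) (A B : set G) : set G :=
  smallest (@is_subgroup G) [set [~ a, b]%g | a in A & b in B].

Definition derived (G : groupType) (A : set G) : set G := commutator A A.

(* The setwise product; it is a subgroup as soon as A and B are subgroups, one
   of them normal. *)
Definition setprod (G : groupType) (A B : set G) : set G :=
  [set (a * b)%g | a in A & b in B].

Definition lcoset (G : groupType) (N : set G) (a : G) : set G :=
  [set (a * n)%g | n in N].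

(* The underlying set of A / N, for N a normal subgroup contained in the
   subgroup A; its neutral element is the coset N. *)
Definition quotient (G : groupType) (A N : set G) : set (set G) :=
  [set lcoset N a | a in A].

Definition nontrivial_quotient (G : groupType) (A N : set G) : Prop :=
  exists2 C, quotient A N C & C <> N.

(* [malg] only provides a ring structure when the basis is a [monomType], which
   excludes nontrivial groups; hence the alias, which keeps the additive
   structure of [malg] and gets the convolution product. *)
Definition group_ring (G : groupType) : Type := {malg int[G]}.

HB.instance Definition _ (G : groupType) := GRing.Zmodule.on (group_ring G).

Definition gring (G : groupType) (g : G) : group_ring G := << g >>.

Section GroupRing.
Variable G : groupType.
Implicit Types (u v w : group_ring G) (g h : G).

Definition gring_mul u v : group_ring G :=
  \sum_(g <- msupp u) \sum_(h <- msupp v) << u@_g * v@_h *g (g * h)%g >>.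

Lemma gring_mulw (d1 d2 : {fset G}) u v :
  (msupp u `<=` d1)%fset -> (msupp v `<=` d2)%fset ->
  gring_mul u v =
    \sum_(g <- d1) \sum_(h <- d2) << u@_g * v@_h *g (g * h)%g >>.
Proof.
move=> le_d1 le_d2; rewrite /gring_mul (big_fset_incl _ le_d1) /=.
  apply/eq_bigr=> k1 _; apply/big_fset_incl => // k _ /mcoeff_outdom ->.
  by rewrite mulr0 monalgU0.
move=> k _ /mcoeff_outdom uk.
by rewrite big1 => // k' _; rewrite uk mul0r monalgU0.
Qed.

Lemma gring_mul0g : left_zero 0 gring_mul.
Proof. by move=> u; rewrite /gring_mul msupp0 big_seq_fset0. Qed.

Lemma gring_mulg0 : right_zero 0 gring_mul.
Proof.
by move=> u; rewrite /gring_mul big1 // => g _; rewrite msupp0 big_seq_fset0.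
Qed.

Lemma gring_mulUU c1 c2 g h :
  gring_mul << c1 *g g >> << c2 *g h >> = << c1 * c2 *g (g * h)%g >>.
Proof. by rewrite (gring_mulw msuppU_le msuppU_le) !big_seq_fset1 !mcoeffUU. Qed.

Lemma gring_mulEl u v :
  gring_mul u v = \sum_(g <- msupp u) gring_mul << u@_g *g g >> v.
Proof.
apply/eq_bigr=> g _; rewrite (gring_mulw msuppU_le (fsubset_refl _)).
by rewrite big_seq_fset1 mcoeffUU.
Qed.

Lemma gring_mulEr u v :
  gring_mul u v = \sum_(h <- msupp v) gring_mul u << v@_h *g h >>.
Proof.
rewrite /gring_mul exchange_big; apply/eq_bigr=> h _.
rewrite -/(gring_mul _ _) (gring_mulw (fsubset_refl _) msuppU_le).
by apply/eq_bigr=> g _; rewrite big_seq_fset1 mcoeffUU.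
Qed.

Lemma gring_mul1g : left_id (gring 1%g) gring_mul.
Proof.
move=> u; rewrite gring_mulEr [RHS]monalgE.
by apply/eq_bigr=> g _; rewrite gring_mulUU mul1r mul1g.
Qed.

Lemma gring_mulg1 : right_id (gring 1%g) gring_mul.
Proof.
move=> u; rewrite gring_mulEl [RHS]monalgE.
by apply/eq_bigr=> g _; rewrite gring_mulUU mulr1 mulg1.
Qed.

Lemma gring_mulDl : left_distributive gring_mul +%R.
Proof.
move=> u v w.
rewrite (gring_mulw (msuppD_le u v) (fsubset_refl _)).
rewrite (gring_mulw (fsubsetUl _ (msupp v)) (fsubset_refl _)).
rewrite (gring_mulw (fsubsetUr (msupp u) _) (fsubset_refl _)).
rewrite -big_split /=; apply/eq_bigr=> g _.
rewrite -big_split /=; apply/eq_bigr=> h _.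
by rewrite mcoeffD mulrDl monalgUD.
Qed.

Lemma gring_mulDr : right_distributive gring_mul +%R.
Proof.
move=> w u v.
rewrite (gring_mulw (fsubset_refl _) (msuppD_le u v)).
rewrite (gring_mulw (fsubset_refl _) (fsubsetUl _ (msupp v))).
rewrite (gring_mulw (fsubset_refl _) (fsubsetUr (msupp u) _)).
rewrite -big_split /=; apply/eq_bigr=> g _.
rewrite -big_split /=; apply/eq_bigr=> h _.
by rewrite mcoeffD mulrDr monalgUD.
Qed.

Lemma gring_mulA : associative gring_mul.
Proof.
have sumL (r : seq G) (E : G -> group_ring G) x :
    gring_mul (\sum_(g <- r) E g) x = \sum_(g <- r) gring_mul (E g) x.
  by apply: (big_morph (gring_mul^~ x) (fun _ _ => gring_mulDl _ _ _)
    (gring_mul0g x)).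
have sumR (r : seq G) (E : G -> group_ring G) x :
    gring_mul x (\sum_(g <- r) E g) = \sum_(g <- r) gring_mul x (E g).
  by apply: (big_morph (gring_mul x) (fun _ _ => gring_mulDr _ _ _)
    (gring_mulg0 x)).
move=> u v w; rewrite [LHS]gring_mulEl (gring_mulEl u v) sumL.
apply/eq_bigr=> g _.
rewrite (gring_mulEl v w) sumR (gring_mulEr _ v) sumL.
apply/eq_bigr=> h _; rewrite gring_mulUU (gring_mulEr _ w) sumR.
rewrite (gring_mulEr _ w); apply/eq_bigr=> k _.
by rewrite !gring_mulUU mulrA mulgA.
Qed.

Lemma gring1_neq0 : gring (1 : G)%g != 0.
Proof. by rewrite monalgU_eq0. Qed.

HB.instance Definition _ := GRing.Zmodule_isNzRing.Build (group_ring G)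
  gring_mulA gring_mul1g gring_mulg1 gring_mulDl gring_mulDr gring1_neq0.

End GroupRing.

Record is_additive_subgroup (A : zmodType) (I : set A) : Prop :=
  IsAdditiveSubgroup {
    additive_subgroup0 : I 0;
    additive_subgroupB : forall x y, I x -> I y -> I (x - y) }.

Record is_ideal (A : nzRingType) (I : set A) : Prop := IsIdeal {
  ideal_additive_subgroup : is_additive_subgroup I;
  idealMl : forall a x, I x -> I (a * x);
  idealMr : forall a x, I x -> I (x * a) }.

Definition ideal_mul (A : nzRingType) (I J : set A) : set A :=
  smallest (@is_additive_subgroup A) [set x * y | x in I & y in J].

(* The two-sided ideal of Z[G] generated by H - 1. *)
Definition normal_ideal (G : groupType) (H : set G) : set (group_ring G) :=
  smallest (@is_ideal _) [set gring h - 1 | h in H].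

(* The intersection of G with 1 + I. *)
Definition dimension_subgroup (G : groupType) (I : set (group_ring G)) :
    set G :=
  [set g | I (gring g - 1)].

Definition fox_numerator (F : groupType) (R S : set F) : set F :=
  let r := normal_ideal R in
  let f := normal_ideal [set: F] in
  let s := normal_ideal S in
  dimension_subgroup (ideal_mul (ideal_mul r f) s).

Definition fox_denominator (F : groupType) (R S : set F) : set F :=
  let R' := derived R in
  let S' := derived S in
  setprod
    (setprod (commutator (R' `&` S') (R `&` S))
             (commutator (R' `&` S) (R' `&` S)))
    (commutator (R `&` S') (R `&` S')).

(* Main.v *)
(* Put K = R :&: S, U = K :&: R' and V = K :&: S'.  Modulo rfs,
   (k, l) |-> (k - 1)(l - 1) is a biadditive pairing on K killing U on the left
   and V on the right, and [~ k, l] - 1 is its antisymmetrization.  If, for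
   i = 1, 2, c_i ^ 2 = u_i v_i with c_i in K, u_i in U and v_i in V, then
   [~ c_1, u_2] [~ u_1, c_2] [~ c_1, c_2]^-2 lies in the numerator; it need not
   lie in the denominator when K / U V contains (Z/2)^2.

   Take F free on a, b, c, let S be the kernel of a |-> 1, b, c |-> 0 onto Z/2
   and R the kernel of the map to the integral Heisenberg group killing a; then
   c_1 = [~ a, b], c_2 = [~ a, c], v_1 = [~ a ^ 2, b], v_2 = [~ a ^ 2, c] and
   u_i = [~ c_i^-1, a] qualify.

   In terms of the counters of [trace] below, xi = b mod 2, which kills U and V,
   and eta = n mod 2, which kills the intersection of U and V, are homomorphisms
   K -> Z/2.  On the generators [~ k, l] of the denominator, sigma mod 2 equals
   xi k * eta l - xi l * eta k = 0, and it is odd on the element above. *)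
Require Import Defs.
From HB Require Import structures.
From mathcomp Require Import all_boot all_algebra.
From mathcomp.classical Require Import classical_sets.
From mathcomp Require Import zify ring.

Set Implicit Arguments.
Unset Strict Implicit.
Unset Printing Implicit Defensive.

Import GRing.Theory.
Local Open Scope ring_scope.
Local Open Scope classical_set_scope.

(** * Free groups *)

Section FreeGroup.
Variable X : choiceType.
Implicit Types (y z : X * bool) (u v w : seq (X * bool)).

Definition letter_inv y : X * bool := (y.1, ~~ y.2).

Lemma letter_invK : involutive letter_inv.
Proof. by case=> x e; rewrite /letter_inv /= negbK. Qed.

(* Words are stored with their last letter at the head, so that adding a
   letter at the head is multiplying on the right by a generator. *)
Definition reduced w := sorted (fun y z => z != letter_inv y) w.

Definition push y w :=
  if w is z :: w' then if z == letter_inv y then w' else y :: w else [:: y].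

Lemma push_reduced y w : reduced w -> reduced (push y w).
Proof.
case: w => [|z w] //= zw; case: (eqVneq z (letter_inv y)) => [_|zy] /=.
  exact: path_sorted zw.
by rewrite zy.
Qed.

Lemma foldr_push_reduced v w : reduced v -> reduced (foldr push v w).
Proof. by move=> rv; elim: w => //= y w; apply: push_reduced. Qed.

Lemma push_cons y w : reduced (y :: w) -> push y w = y :: w.
Proof. by case: w => [|z w] //= /andP[/negPf->]. Qed.

Lemma foldr_push_nil w : reduced w -> foldr push [::] w = w.
Proof.
elim: w => //= y w IHw ryw.
by rewrite IHw ?push_cons //; apply: path_sorted ryw.
Qed.

Lemma pushK y w : reduced w -> push (letter_inv y) (push y w) = w.
Proof.
case: w => [|z w] rw /=; first by rewrite letter_invK eqxx.
case: (eqVneq z (letter_inv y)) => [<-|_]; first exact: push_cons.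
by rewrite /push letter_invK eqxx.
Qed.

(** When [push] cancels, [step y] undoes the step of the cancelled letter, so a fold with invertible
    steps depends only on the free reduction of a word. *)
Lemma foldr_push (A : Type) (step : X * bool -> A -> A) (s : A) y w :
    (forall y, cancel (step y) (step (letter_inv y))) ->
  foldr step s (push y w) = step y (foldr step s w).
Proof.
move=> stepK; case: w => [|z w] //=; case: eqP => [->|] //=.
by rewrite -{1}[y]letter_invK stepK.
Qed.

Record freegroup := FreeGroup { word :> seq (X * bool); _ : reduced word }.

HB.instance Definition _ := [isSub for word].
HB.instance Definition _ := [Choice of freegroup by <:].

Implicit Types g h k : freegroup.

Lemma word_reduced g : reduced g. Proof. exact: valP. Qed.

Definition freegroup_one := @FreeGroup [::] isT.
Definition freegroup_mul g h :=
  FreeGroup (foldr_push_reduced h (word_reduced g)).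
Definition freegroup_inv g :=
  FreeGroup (@foldr_push_reduced [::] (rev (map letter_inv g)) isT).

Lemma foldr_push_push u y w : reduced u -> reduced w ->
  foldr push u (push y w) = push y (foldr push u w).
Proof.
move=> ru; case: w => [|z w] //= rzw; case: eqP => [->|] //=.
by rewrite -{1}[y]letter_invK pushK //; apply: foldr_push_reduced.
Qed.

Lemma foldr_push_foldr u v w : reduced u -> reduced v ->
  foldr push u (foldr push v w) = foldr push (foldr push u v) w.
Proof.
move=> ru rv; elim: w => //= y w IHw.
by rewrite foldr_push_push ?IHw //; apply: foldr_push_reduced.
Qed.

Lemma foldr_push_inv u w : reduced u ->
  foldr push u (w ++ rev (map letter_inv w)) = u.
Proof.
elim: w u => //= y w IHw u ru.
rewrite rev_cons -rcons_cat -cats1 foldr_cat /= IHw ?push_reduced //.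
by rewrite -{1}[y]letter_invK pushK.
Qed.

Lemma freegroup_mulA : associative freegroup_mul.
Proof.
by move=> g h k; apply: val_inj; rewrite /= foldr_push_foldr ?word_reduced.
Qed.

Lemma freegroup_mul1g : left_id freegroup_one freegroup_mul.
Proof.
by move=> g; apply: val_inj; rewrite /= foldr_push_nil ?word_reduced.
Qed.

Lemma freegroup_mulg1 : right_id freegroup_one freegroup_mul.
Proof. by move=> g; apply: val_inj. Qed.

Lemma freegroup_mulVg :
  left_inverse freegroup_one freegroup_inv freegroup_mul.
Proof.
by move=> g; apply: val_inj; rewrite /= -foldr_cat foldr_push_inv.
Qed.

Lemma freegroup_mulgV :
  right_inverse freegroup_one freegroup_inv freegroup_mul.
Proof.
move=> g; apply: val_inj; rewrite /= foldr_push_foldr ?word_reduced //=.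
rewrite -{1}(foldr_push_nil (word_reduced g)) -foldr_cat.
have {2}-> : word g = rev (map letter_inv (rev (map letter_inv g))).
  by rewrite map_rev revK mapK //; apply: letter_invK.
by rewrite foldr_push_inv.
Qed.

HB.instance Definition _ := isGroup.Build freegroup freegroup_mulA
  freegroup_mul1g freegroup_mulg1 freegroup_mulVg freegroup_mulgV.

Definition freegroup_gen (x : X) : freegroup := @FreeGroup [:: (x, true)] isT.

Lemma freegroup_ind (P : freegroup -> Prop) :
    P 1%g -> (forall g x, P g -> P (g * freegroup_gen x)%g) ->
    (forall g x, P g -> P (g * (freegroup_gen x)^-1)%g) ->
  forall g, P g.
Proof.
move=> P1 PM PMV [w rw]; elim: w rw => [|[x e] w IHw] rw.
  by rewrite (_ : FreeGroup rw = 1%g) //; apply: val_inj.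
have rw' : reduced w by apply: path_sorted rw.
have := IHw rw'; case: e rw => rw Pw.
  rewrite (_ : FreeGroup rw = FreeGroup rw' * freegroup_gen x)%g.
    exact: PM.
  by apply: val_inj; rewrite /= push_cons.
rewrite (_ : FreeGroup rw = FreeGroup rw' * (freegroup_gen x)^-1)%g.
  exact: PMV.
by apply: val_inj; rewrite /= -[RHS]/(push (x, false) w) push_cons.
Qed.

Section Run.
Variables (A : Type) (step : X * bool -> A -> A) (s : A).
Hypothesis stepK : forall y, cancel (step y) (step (letter_inv y)).

(** As the last letter sits at the head, the fold reads a word from left to right: it is the orbit
    map at [s] of a right action. *)
Definition run g := foldr step s g.

Lemma run1 : run 1%g = s. Proof. by []. Qed.

Lemma runM g x : run (g * freegroup_gen x)%g = step (x, true) (run g).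
Proof. by rewrite /run /= foldr_push. Qed.

Lemma runMV g x : run (g * (freegroup_gen x)^-1)%g = step (x, false) (run g).
Proof. by rewrite /run /= foldr_push. Qed.

End Run.

Lemma freegroup_free_on : is_free_on freegroup_gen.
Proof.
move=> G f; pose step y (g : G) := (g * if y.2 then f y.1 else (f y.1)^-1)%g.
have stepK y : cancel (step y) (step (letter_inv y)).
  by case: y => x [] g; rewrite /step /= ?mulgK ?mulgVK.
exists (run step 1%g); split.
- split; first exact: run1.
  move=> g; elim/freegroup_ind => [|h x IHh|h x IHh]; first by rewrite !mulg1.
  + by rewrite mulgA !runM // IHh /step mulgA.
  + by rewrite mulgA !runMV // IHh /step mulgA.
- by move=> x; rewrite -[freegroup_gen x]mul1g runM // run1 /step mul1g.
move=> psi [psi1 psiM] psif.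
elim/freegroup_ind => [|h x IHh|h x IHh]; first by rewrite psi1.
- by rewrite psiM runM // IHh psif.
rewrite runMV // -IHh /step /= -psif.
by apply: (mulIg (psi (freegroup_gen x))); rewrite -psiM !mulgVK.
Qed.

End FreeGroup.

Lemma freegroup_is_free (X : choiceType) : is_free (freegroup X).
Proof. by exists X, (@freegroup_gen X); apply: freegroup_free_on. Qed.

(** * Products of ideals in the group ring *)

Section Ideals.
Variable A : nzRingType.
Implicit Types (I J L : set A) (x y z : A).

Lemma additive_subgroupN I x : is_additive_subgroup I -> I x -> I (- x).
Proof. by case=> I0 IB Ix; rewrite -sub0r; apply: IB. Qed.

Lemma additive_subgroupD I x y :
  is_additive_subgroup I -> I x -> I y -> I (x + y).
Proof.
move=> Isub Ix /(additive_subgroupN Isub) IN; rewrite -[y]opprK.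
by case: Isub => _; apply.
Qed.

Lemma smallest_additive_subgroup (E : set A) :
  is_additive_subgroup (smallest (@is_additive_subgroup A) E).
Proof.
split=> [|x y Ex Ey] M [Msub EM]; first by case: Msub.
by case: (Msub) => _; apply; [apply: Ex | apply: Ey].
Qed.

Lemma smallest_ideal (E : set A) : is_ideal (smallest (@is_ideal A) E).
Proof.
split=> [|a x Ex M [Mid EM]|a x Ex M [Mid EM]].
- split=> [|x y Ex Ey] M [Mid EM]; first by case: Mid => -[].
  by case: (Mid) => -[_ MB] _ _; apply: MB; [apply: Ex | apply: Ey].
- by case: (Mid) => _ M1 _; apply: M1; apply: Ex.
- by case: (Mid) => _ _ M2; apply: M2; apply: Ex.
Qed.

Lemma ideal_mul_mem I J x y : I x -> J y -> ideal_mul I J (x * y).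
Proof. by move=> Ix Jy; apply: sub_gen_smallest; exists x => //; exists y. Qed.

Lemma ideal_mul_ideal I J :
  is_ideal I -> is_ideal J -> is_ideal (ideal_mul I J).
Proof.
move=> Iid Jid; have [S0 SB] := smallest_additive_subgroup
  [set x * y | x in I & y in J]; split; first by split.
- move=> a; apply: (@smallest_sub _ _ _ [set z | ideal_mul I J (a * z)]).
    split=> [|x y] /=; first by rewrite mulr0.
    by rewrite mulrBr; apply: SB.
  move=> _ [x Ix] [y Jy] <- /=; rewrite mulrA; apply: ideal_mul_mem => //.
  by case: Iid => _ IM _; apply: IM.
- move=> a; apply: (@smallest_sub _ _ _ [set z | ideal_mul I J (z * a)]).
    split=> [|x y] /=; first by rewrite mul0r.
    by rewrite mulrBl; apply: SB.
  move=> _ [x Ix] [y Jy] <- /=; rewrite -mulrA; apply: ideal_mul_mem => //.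
  by case: Jid => _ _ JM; apply: JM.
Qed.

(** The product rfs is bracketed as (rf)s, whereas S' - 1 lies in fs; this half of associativity
    puts (R - 1)(S' - 1) into rfs. *)
Lemma ideal_mulA_mem I J L x y :
  I x -> ideal_mul J L y -> ideal_mul (ideal_mul I J) L (x * y).
Proof.
move=> Ix; have [S0 SB] := smallest_additive_subgroup
  [set x * y | x in ideal_mul I J & y in L].
apply: (@smallest_sub _ _ _ [set z | ideal_mul (ideal_mul I J) L (x * z)]).
  split=> [|z t] /=; first by rewrite mulr0.
  by rewrite mulrBr; apply: SB.
move=> _ [z Jz] [t Lt] <- /=; rewrite mulrA.
by apply: ideal_mul_mem => //; apply: ideal_mul_mem.
Qed.

End Ideals.

(** * Commutators and normal subgroups *)

Section Subgroups.
Variable G : groupType.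
Implicit Types (A B H N : set G) (g h x y : G).

Lemma commutator_mem A B x y : A x -> B y -> commutator A B [~ x, y]%g.
Proof. by move=> Ax By; apply: sub_gen_smallest; exists x => //; exists y. Qed.

Lemma commutator_sub A B H : is_subgroup H ->
  (forall x y, A x -> B y -> H [~ x, y]%g) -> commutator A B `<=` H.
Proof.
by move=> Hsub HAB; apply: smallest_sub => // _ [x Ax] [y By] <-; apply: HAB.
Qed.

Lemma subgroup_conj H x y : is_subgroup H -> H x -> H y -> H (x ^ y)%g.
Proof.
by case=> _ HM HV Hx Hy; rewrite conjgE; apply: (HM); [apply: HV | apply: HM].
Qed.

Lemma subgroup_commg H x y : is_subgroup H -> H x -> H y -> H [~ x, y]%g.
Proof.
move=> Hsub Hx Hy; rewrite commgEl; case: (Hsub) => _ HM HV.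
by apply: HM; [apply: HV | apply: subgroup_conj].
Qed.

Lemma derived_sub H : is_subgroup H -> derived H `<=` H.
Proof.
by move=> Hsub; apply: commutator_sub => // x y Hx Hy; apply: subgroup_commg.
Qed.

Lemma normal_commg H x y : is_normal H -> H x -> H [~ x, y]%g.
Proof.
case=> [[_ HM HV] HJ] Hx; rewrite commgEl.
by apply: HM; [apply: HV | apply: HJ].
Qed.

Lemma setprod_sub A B H :
  is_subgroup H -> A `<=` H -> B `<=` H -> setprod A B `<=` H.
Proof. by case=> _ HM _ AH BH _ [x /AH Hx] [y /BH Hy] <-; apply: HM. Qed.

End Subgroups.

Section Congruence.
Variables (A : nzRingType) (I : set A).
Hypothesis Iid : is_ideal I.
Implicit Types x y z : A.

Definition eqmod x y := I (x - y).

Let Isub : is_additive_subgroup I. Proof. by case: Iid. Qed.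

Lemma eqmod_sym x y : eqmod x y -> eqmod y x.
Proof. by move/(additive_subgroupN Isub); rewrite opprB. Qed.

Lemma eqmod_trans y x z : eqmod x y -> eqmod y z -> eqmod x z.
Proof.
by move=> xy /(additive_subgroupD Isub xy); rewrite addrA subrK.
Qed.

Lemma eqmodD x y x' y' : eqmod x y -> eqmod x' y' -> eqmod (x + x') (y + y').
Proof.
by move=> xy /(additive_subgroupD Isub xy); rewrite addrACA -opprD.
Qed.

Lemma eqmodN x y : eqmod x y -> eqmod (- x) (- y).
Proof. by move/(additive_subgroupN Isub); rewrite opprD. Qed.

Lemma eqmodDr x y : I y -> eqmod (x + y) x.
Proof. by rewrite /eqmod addrC addKr. Qed.

Lemma eqmodMr a x y : eqmod x y -> eqmod (x * a) (y * a).
Proof. by case: Iid => _ _ IM /(IM a); rewrite mulrBl. Qed.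

(** The last hypothesis is (1 + c)^2 = (1 + u)(1 + v); after left multiplication by [a], the others
    discard every term but au and 2ac. *)
Lemma eqmod_pairing a c u v :
    I (a * v) -> I (a * u * v) -> I (a * c * c) ->
    c + c + c * c = u + v + u * v ->
  eqmod (a * u) (a * c + a * c).
Proof.
move=> Iav Iauv Iacc /(congr1 ( *%R a)); rewrite !mulrDr !mulrA => E.
apply: (eqmod_trans (eqmod_sym (eqmodDr _ Iav))).
apply: (eqmod_trans (eqmod_sym (eqmodDr _ Iauv))).
by rewrite -E; apply: eqmodDr.
Qed.

(** The two sides are (1 + x)(1 + y) - 1 and (1 + z)^2 - 1; without their quadratic terms they agree
    as 2p - 2q = 2(p - q). *)
Lemma eqmod_double x y z p q : I (x * y) -> I (z * z) ->
    eqmod x (p + p) -> eqmod y (- (q + q)) -> eqmod z (p - q) ->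
  eqmod (x + y + x * y) (z + z + z * z).
Proof.
move=> Ixy Izz xp yq zpq; apply: (eqmod_trans (eqmodDr _ Ixy)).
apply: eqmod_trans (eqmod_sym (eqmodDr _ Izz)).
apply: (eqmod_trans (eqmodD xp yq)); rewrite opprD addrACA.
exact/eqmod_sym/eqmodD.
Qed.

End Congruence.

(** * The elements g - 1 and dimension subgroups *)

Section GroupRingElements.
Variable G : groupType.
Implicit Types (g h k l : G) (H : set G).
Local Notation e g := (gring g - 1).

Lemma gringM g h : gring (g * h)%g = gring g * gring h.
Proof. by rewrite /GRing.mul /= gring_mulUU mulr1. Qed.

Lemma gringB1M g h : e (g * h)%g = e g + e h + e g * e h.
Proof.
rewrite mulrBr mulr1 mulrBl mul1r -gringM.
by rewrite [e g + e h]addrC -addrA [e g + _]addrC subrK addrC addrA subrK.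
Qed.

Lemma gringB1_comm g h :
  gring (g * h)%g - gring (h * g)%g = e g * e h - e h * e g.
Proof.
rewrite -[gring (g * h)%g](subrK 1) -[gring (h * g)%g](subrK 1) opprD addrACA.
rewrite subrr addr0 (gringB1M g) (gringB1M h) [e h + e g]addrC.
by rewrite opprD addrACA subrr add0r.
Qed.

Lemma dimension_subgroup_subgroup (I : set (group_ring G)) :
  is_ideal I -> is_subgroup (dimension_subgroup I).
Proof.
move=> [Isub IMl IMr].
split=> [|x y Ix Iy|x Ix]; rewrite /dimension_subgroup /=.
- by rewrite subrr; case: Isub.
- rewrite gringB1M; apply: additive_subgroupD => //; last exact: IMl.
  exact: (additive_subgroupD Isub Ix Iy).
- have -> : e x^-1%g = - (gring x^-1%g * e x).
    by rewrite mulrBr mulr1 -gringM mulVg opprB.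
  by apply: additive_subgroupN => //; apply: IMl.
Qed.

Lemma eqmod_dimension_subgroup (I : set (group_ring G)) g h :
  is_ideal I -> eqmod I (gring g) (gring h) ->
  dimension_subgroup I (g * h^-1)%g.
Proof.
move=> Iid /(eqmodMr Iid (gring h^-1%g)).
by rewrite -!gringM mulgV.
Qed.

Lemma normal_ideal_mem H g : H g -> normal_ideal H (e g).
Proof. by move=> Hg; apply: sub_gen_smallest; exists g. Qed.

(** From xy = yx[x, y], the element [x, y] - 1 is a unit times (x - 1)(y - 1) - (y - 1)(x - 1). Both
    orders occur, so H - 1 is asked to lie in both ideals. *)
Lemma derived_dimension_subgroup (I J : set (group_ring G)) H :
    is_ideal I -> is_ideal J -> (forall g, H g -> I (e g) /\ J (e g)) ->
  derived H `<=` dimension_subgroup (ideal_mul I J).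
Proof.
move=> Iid Jid HIJ; have IJid := ideal_mul_ideal Iid Jid.
apply: commutator_sub; first exact: dimension_subgroup_subgroup.
move=> x y /HIJ[Ix Jx] /HIJ[Iy Jy]; rewrite /dimension_subgroup /=.
have -> : e [~ x, y]%g = gring (y * x)^-1%g * (e x * e y - e y * e x).
  rewrite -gringB1_comm mulrBr -!gringM mulVg; congr (gring _ - 1).
  by rewrite [(x * y)%g]commgC mulKg.
case: (IJid) => [[_ IJB] IJM _]; apply: IJM; apply: IJB; exact: ideal_mul_mem.
Qed.

End GroupRingElements.

(** * Elements of the numerator built from commutators *)

Section Numerator.
Variables (G : groupType) (R S : set G).
Hypotheses (Rn : is_normal R) (Sn : is_normal S).
Local Notation e g := (gring g - 1).
Local Notation r := (normal_ideal R).
Local Notation f := (normal_ideal [set: G]).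
Local Notation s := (normal_ideal S).
Local Notation I := (ideal_mul (ideal_mul r f) s).
Local Notation "x == y" := (eqmod I x y).

Let rid : is_ideal r := smallest_ideal _.
Let fid : is_ideal f := smallest_ideal _.
Let sid : is_ideal s := smallest_ideal _.
Let Iid : is_ideal I := ideal_mul_ideal (ideal_mul_ideal rid fid) sid.

Let derivedR g : derived R g -> ideal_mul r f (e g).
Proof.
apply: derived_dimension_subgroup => // h Rh.
by split; apply: normal_ideal_mem.
Qed.

Let derivedS g : derived S g -> ideal_mul f s (e g).
Proof.
apply: derived_dimension_subgroup => // h Rh.
by split; apply: normal_ideal_mem.
Qed.

Let rfs g h k : R g -> S k -> I (e g * e h * e k).
Proof.
by move=> Rg Sk; do 2?[apply: ideal_mul_mem]; apply: normal_ideal_mem.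
Qed.

(** Here kl - lk = lk([k, l] - 1), and replacing the factor lk by 1 costs (lk - 1)([k, l] - 1),
    which lies in r(fs). *)
Lemma gringB1_commg k l : (R `&` S) k -> (R `&` S) l ->
  e [~ k, l]%g == e k * e l - e l * e k.
Proof.
move=> [Rk Sk] [Rl Sl]; rewrite -gringB1_comm; apply: (eqmod_sym Iid).
have -> : gring (k * l)%g - gring (l * k)%g = gring (l * k)%g * e [~ k, l]%g.
  by rewrite mulrBr mulr1 -gringM -commgC.
rewrite /eqmod -[X in _ - X]mul1r -mulrBl.
apply: ideal_mulA_mem.
  by apply: normal_ideal_mem; case: (Rn) => -[_ RM _] _; apply: RM.
by apply: derivedS; apply: commutator_mem.
Qed.

(* Modulo rfs, [c * c = u * v] reads 2c = u + v in the pairing with k. *)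
Lemma gringB1_pairing k c u v :
    R k -> (R `&` S) c -> S u -> derived S v -> (c * c = u * v)%g ->
  e k * e u == e k * e c + e k * e c.
Proof.
move=> Rk [Rc Sc] Su S'v cc_uv.
have Ikv : I (e k * e v).
  by apply: ideal_mulA_mem; [apply: normal_ideal_mem | apply: derivedS].
have Ikuv : I (e k * e u * e v).
  by apply: rfs => //; apply: derived_sub S'v; case: Sn.
have Ikcc : I (e k * e c * e c) by apply: rfs.
by apply: (eqmod_pairing Iid Ikv Ikuv Ikcc); rewrite -!gringB1M cc_uv.
Qed.

(** Put p = (c1 - 1)(c2 - 1) and q = (c2 - 1)(c1 - 1). Modulo rfs, [c1, u2] - 1 is 2p, [u1, c2] - 1
    is -2q and [c1, c2] - 1 is p - q, while products of two such differences vanish. *)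
Lemma fox_numerator_commg c1 c2 u1 u2 v1 v2 :
    (R `&` S) c1 -> (R `&` S) c2 ->
    (derived R `&` S) u1 -> (derived R `&` S) u2 ->
    derived S v1 -> derived S v2 ->
    (c1 * c1 = u1 * v1)%g -> (c2 * c2 = u2 * v2)%g ->
  fox_numerator R S ([~ c1, u2] * [~ u1, c2] * ([~ c1, c2] * [~ c1, c2])^-1)%g.
Proof.
move=> Kc1 Kc2 [R'u1 Su1] [R'u2 Su2] S'v1 S'v2 E1 E2.
have R'R : derived R `<=` R by apply: derived_sub; case: Rn.
have Ku1 : (R `&` S) u1 by split=> //; apply: R'R.
have Ku2 : (R `&` S) u2 by split=> //; apply: R'R.
have IR'S g h : derived R g -> S h -> I (e g * e h).
  move=> R'g Sh; apply: ideal_mul_mem; last exact: normal_ideal_mem.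
  exact: derivedR.
have IK k l k' l' :
    (R `&` S) k -> (R `&` S) l -> (R `&` S) k' -> (R `&` S) l' ->
    I (e [~ k, l]%g * e [~ k', l']%g).
  move=> [Rk _] [Rl _] [_ Sk] [_ Sl]; apply: IR'S; first exact: commutator_mem.
  by apply: subgroup_commg; case: Sn.
apply: (eqmod_dimension_subgroup Iid).
suff : e ([~ c1, u2] * [~ u1, c2])%g == e ([~ c1, c2] * [~ c1, c2])%g.
  by rewrite /eqmod opprB addrA subrK.
rewrite (gringB1M [~ c1, u2]%g [~ u1, c2]%g)
  (gringB1M [~ c1, c2]%g [~ c1, c2]%g).
apply: (eqmod_double Iid (p := e c1 * e c2) (q := e c2 * e c1)).
- exact: IK.
- exact: IK.
- apply: (eqmod_trans Iid (gringB1_commg Kc1 Ku2)).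
  apply: (eqmod_trans Iid _ (gringB1_pairing (proj1 Kc1) Kc2 Su2 S'v2 E2)).
  apply: eqmodDr (additive_subgroupN (ideal_additive_subgroup Iid) _).
  exact: (IR'S _ _ R'u2 (proj2 Kc1)).
- apply: (eqmod_trans Iid (gringB1_commg Ku1 Kc2)); rewrite addrC.
  apply: (eqmod_trans Iid (eqmodDr _ (IR'S _ _ R'u1 (proj2 Kc2)))).
  apply: (eqmodN Iid).
  exact: (gringB1_pairing (proj1 Kc2) Kc1 Su1 S'v1 E1).
- exact: gringB1_commg.
Qed.

End Numerator.

(** * Reading words with a counter *)

Section AdditiveModulo.
Variables (G : groupType) (H : set G) (d : int) (phi : G -> int).
Hypothesis Hsub : is_subgroup H.
Hypothesis phiM :
  forall x y, H x -> H y -> (d %| phi (x * y)%g - (phi x + phi y))%Z.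

Lemma additive_modulo_dvd x y : H x -> H y -> (d %| phi x)%Z ->
  (d %| phi (x * y)%g)%Z = (d %| phi y)%Z.
Proof.
move=> Hx Hy dx; rewrite -[phi (x * y)%g](subrK (phi x + phi y)).
by rewrite rpredDl ?phiM // rpredDl.
Qed.

(** Modulo [d], [phi] is a homomorphism from H to an abelian group. The case d = 0 gives exact
    vanishing, d = 2 gives parity. *)
Lemma additive_modulo_derived g : derived H g -> (d %| phi g)%Z.
Proof.
have [H1 HM HV] := Hsub.
have phi1 : (d %| phi 1%g)%Z.
  by have := phiM H1 H1; rewrite mulg1 opprD addNKr rpredN.
suff : derived H `<=` [set g | H g /\ (d %| phi g)%Z] by move=> sub /sub[].
apply: commutator_sub => [|x y Hx Hy].
  split=> [|x y [Hx dx] [Hy dy]|x [Hx dx]]; split=> //.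
  - exact: HM.
  - by rewrite additive_modulo_dvd.
  - exact: HV.
  - by rewrite -(additive_modulo_dvd Hx) ?mulgV //; apply: HV.
have Hxy := subgroup_commg Hsub Hx Hy; split=> //.
have /dvdzP[p Ep] := phiM Hx Hy.
have /dvdzP[q Eq] := phiM Hy Hx.
have := phiM (HM _ _ Hy Hx) Hxy; rewrite -commgC => /dvdzP[r Er].
apply/dvdzP; exists (p - q - r); rewrite !mulrBl -Ep -Eq -Er; ring.
Qed.
End AdditiveModulo.

(* A word in a, b, c (encoded as None, Some false, Some true) is read from left
   to right.  The exponent sum of a is 2 m + e with e a bit, and j, l are those
   of b and c; the other counters are sums over the letters b^q or c^q of q
   times a function of the prefix: b = sum_b q e, t = sum_c q e, n = sum_c q m,
   h = sum_c q j, tau = sum_c q b and sigma = sum_c q b m. *)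
Record trace := Trace {
  tr_e : bool; tr_m : int; tr_j : int; tr_l : int; tr_b : int; tr_t : int;
  tr_n : int; tr_h : int; tr_tau : int; tr_sigma : int }.

Definition trace_one := Trace false 0 0 0 0 0 0 0 0 0.

Definition int_of_bool (e : bool) : int := if e then 1 else 0.

(** In the [None] case q is added to 2 m + e; the two [int_of_bool] terms together give the carry or
    borrow into m. *)
Definition trace_step (y : option bool * bool) (s : trace) : trace :=
  let: Trace e m j l b t n h tau sigma := s in
  let q : int := if y.2 then 1 else -1 in
  match y.1 with
  | None => Trace (~~ e) (m + int_of_bool e - int_of_bool (~~ y.2))
                  j l b t n h tau sigma
  | Some false => Trace e m (j + q) l (b + q * int_of_bool e) t n h tau sigma
  | Some true => Trace e m j (l + q) b (t + q * int_of_bool e) (n + q * m)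
                       (h + q * j) (tau + q * b) (sigma + q * (b * m))
  end.

(** A letter b or c changes counters by amounts depending only on counters that it leaves fixed, so
    the inverse letter undoes it. *)
Lemma trace_stepK (y : option bool * bool) :
  cancel (trace_step y) (trace_step (letter_inv y)).
Proof.
case: y => [[[]|] []] [[] m j l b t n h tau sigma] /=; congr Trace => /=; ring.
Qed.

Section Trace.
Local Notation F := (freegroup (option bool)).
Local Notation tr := (run trace_step trace_one).

(** Reading [h] after [g] shifts the prefix values seen along [h]. An odd [g] turns e into 1 - e,
    hence b into j - b and m into m + e up to constants; for sigma this would bring in sums not
    recorded, such as that of q j m. *)
Lemma traceM (g h : F) :
  [/\ tr_e (tr (g * h)%g) = tr_e (tr g) (+) tr_e (tr h),
      tr_m (tr (g * h)%g) = tr_m (tr g) + tr_m (tr h) +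
                            int_of_bool (tr_e (tr g) && tr_e (tr h)),
      tr_j (tr (g * h)%g) = tr_j (tr g) + tr_j (tr h),
      tr_l (tr (g * h)%g) = tr_l (tr g) + tr_l (tr h) &
      tr_h (tr (g * h)%g) =
        tr_h (tr g) + tr_h (tr h) + tr_j (tr g) * tr_l (tr h)] /\
  [/\ tr_b (tr (g * h)%g) = tr_b (tr g) +
        (if tr_e (tr g) then tr_j (tr h) - tr_b (tr h) else tr_b (tr h)),
      tr_t (tr (g * h)%g) = tr_t (tr g) +
        (if tr_e (tr g) then tr_l (tr h) - tr_t (tr h) else tr_t (tr h)),
      tr_n (tr (g * h)%g) = tr_n (tr g) + tr_n (tr h) +
        tr_m (tr g) * tr_l (tr h) + (if tr_e (tr g) then tr_t (tr h) else 0),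
      tr_tau (tr (g * h)%g) =
        tr_tau (tr g) + tr_b (tr g) * tr_l (tr h) +
        (if tr_e (tr g) then tr_h (tr h) - tr_tau (tr h) else tr_tau (tr h)) &
      ~~ tr_e (tr g) -> tr_sigma (tr (g * h)%g) =
        tr_sigma (tr g) + tr_sigma (tr h) + tr_m (tr g) * tr_tau (tr h) +
        tr_b (tr g) * tr_n (tr h) + tr_b (tr g) * tr_m (tr g) * tr_l (tr h)].
Proof.
elim/freegroup_ind: h => [|h x|h x].
- rewrite mulg1 [tr 1%g]run1.
  by case: (tr g) => [[] m j l b t n h tau sigma] /=;
    do 2!split=> //= *; ring.
- rewrite mulgA !(runM _ trace_stepK).
  case: (tr g) => [e m j l b t n hh tau sigma].
  case: (tr h) => [e' m' j' l' b' t' n' h' tau' sigma'].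
  case: (tr (g * h)%g) => [? ? ? ? ? ? ? ? ? sigma''] /=.
  move=> [[-> -> -> -> ->]] [-> -> -> ->].
  by case: x => [[]|]; case: e; case: e' => /= E;
    do 2!split=> //= *; rewrite ?E //=; ring.
- rewrite mulgA !(runMV _ trace_stepK).
  case: (tr g) => [e m j l b t n hh tau sigma].
  case: (tr h) => [e' m' j' l' b' t' n' h' tau' sigma'].
  case: (tr (g * h)%g) => [? ? ? ? ? ? ? ? ? sigma''] /=.
  move=> [[-> -> -> -> ->]] [-> -> -> ->].
  by case: x => [[]|]; case: e; case: e' => /= E;
    do 2!split=> //= *; rewrite ?E //=; ring.
Qed.

Local Notation e g := (tr_e (tr g)).
Local Notation m g := (tr_m (tr g)).
Local Notation j g := (tr_j (tr g)).
Local Notation l g := (tr_l (tr g)).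
Local Notation h g := (tr_h (tr g)).
Local Notation b g := (tr_b (tr g)).
Local Notation t g := (tr_t (tr g)).
Local Notation n g := (tr_n (tr g)).
Local Notation tau g := (tr_tau (tr g)).
Local Notation sigma g := (tr_sigma (tr g)).

Definition groupR : set F := [set g | [/\ j g = 0, l g = 0 & h g = 0]].
Definition groupS : set F := [set g | ~~ e g].

Lemma groupR_normal : is_normal groupR.
Proof.
have jlV x : j x^-1%g = - j x /\ l x^-1%g = - l x.
  have [[_ _ jM lM _] _] := traceM x x^-1%g.
  by move: jM lM; rewrite mulgV [tr 1%g]run1 /=; lia.
have hV x : h x^-1%g = - h x + j x * l x.
  have [[_ _ _ _]] := traceM x x^-1%g; rewrite (jlV x).2 mulgV [tr 1%g]run1 /=.
  by move=> hM _; lia.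
have RM x y : groupR x -> groupR y -> groupR (x * y)%g.
  move=> [jx lx hx] [jy ly hy].
  have [[_ _ jM lM hM] _] := traceM x y.
  by split; rewrite ?jM ?lM ?hM; lia.
split; first split=> //.
- by move=> x [jx lx hx]; split; rewrite ?hV ?(jlV x).1 ?(jlV x).2; lia.
move=> x y [jx lx hx]; rewrite conjgE.
have [[_ _ jM lM hM] _] := traceM x y.
have [[_ _ jM' lM' hM'] _] := traceM y^-1%g (x * y)%g.
have [jV lV] := jlV y.
split; rewrite ?jM' ?lM' ?hM' ?hV ?jV ?lV ?jM ?lM ?hM ?jx ?lx ?hx; ring.
Qed.

Lemma groupS_normal : is_normal groupS.
Proof.
have eM x y : e (x * y)%g = e x (+) e y by have [[]] := traceM x y.
have eV x : e x^-1%g = e x.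
  have := eM x x^-1%g; rewrite mulgV [tr 1%g]run1 /=.
  by case: (e x); case: (e x^-1%g).
split; first split; rewrite /groupS //=.
- by move=> x y /negPf ex /negPf ey; rewrite eM ex ey.
- by move=> x; rewrite eV.
by move=> x y /negPf ex; rewrite conjgE !eM eV ex; case: (e y).
Qed.

(** On R, where j = l = h = 0, the sums 2 m + e and 2 n + t are additive, while b and tau are
    additive up to sign, hence modulo 2. *)
Lemma derivedR_trace g : derived groupR g ->
  [/\ ~~ e g, m g = 0, 2 * n g + t g = 0, (2 %| b g)%Z & (2 %| tau g)%Z].
Proof.
have Rsub := normal_subgroup groupR_normal => R'g.
have im : m g * 2 + int_of_bool (e g) = 0.
  apply/eqP; rewrite -dvd0z.
  apply: (additive_modulo_derived
    (phi := fun g => m g * 2 + int_of_bool (e g))) R'g => // x y _ _.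
  have [[-> -> _ _ _] _] := traceM x y.
  by rewrite dvd0z; case: (e x); case: (e y) => /=; lia.
have nt : 2 * n g + t g = 0.
  apply/eqP; rewrite -dvd0z.
  apply: (additive_modulo_derived (phi := fun g => 2 * n g + t g)) R'g => //.
  move=> x y _ [_ ly _]; have [_ [_ -> -> _ _]] := traceM x y.
  by rewrite dvd0z ly; case: (e x); lia.
split=> //; try by move: im; case: (e g) => /=; lia.
- apply: (additive_modulo_derived (phi := fun g => b g)) R'g => //.
  move=> x y _ [jy _ _]; have [_ [-> _ _ _ _]] := traceM x y.
  by rewrite jy; case: (e x); apply/dvdzP; [exists (- b y) | exists 0]; ring.
- apply: (additive_modulo_derived (phi := fun g => tau g)) R'g => //.
  move=> x y _ [_ ly hy]; have [_ [_ _ _ -> _]] := traceM x y.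
  rewrite ly hy.
  by case: (e x); apply/dvdzP; [exists (- tau y) | exists 0]; ring.
Qed.

Lemma derivedS_trace g : derived groupS g -> [/\ m g = 0, b g = 0 & t g = 0].
Proof.
have Ssub := normal_subgroup groupS_normal => S'g.
split; apply/eqP; rewrite -dvd0z.
- apply: (additive_modulo_derived (phi := fun g => m g)) S'g => //.
  move=> x y /negPf ex _; have [[_ -> _ _ _] _] := traceM x y.
  by rewrite ex dvd0z /=; lia.
- apply: (additive_modulo_derived (phi := fun g => b g)) S'g => //.
  move=> x y /negPf ex _; have [_ [-> _ _ _ _]] := traceM x y.
  by rewrite ex dvd0z /=; lia.
- apply: (additive_modulo_derived (phi := fun g => t g)) S'g => //.
  move=> x y /negPf ex _; have [_ [_ -> _ _ _]] := traceM x y.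
  by rewrite ex dvd0z /=; lia.
Qed.

(** * The parity of sigma on the intersection of R and S *)

Lemma groupRS_traceM x y : (groupR `&` groupS) x -> (groupR `&` groupS) y ->
  [/\ m (x * y)%g = m x + m y, b (x * y)%g = b x + b y,
      n (x * y)%g = n x + n y &
      sigma (x * y)%g = sigma x + sigma y + m x * tau y + b x * n y].
Proof.
move=> [_ /negPf ex] [[_ ly _] _].
have [[_ -> _ _ _] [-> _ -> _ ->]] := traceM x y; rewrite ?ex // ly.
by rewrite !mulr0 !addr0.
Qed.

(** Requiring m = b = 0 removes the correction terms of [groupRS_traceM], so that sigma is additive
    here. *)
Definition even_sigma : set F :=
  [set g | (groupR `&` groupS) g /\
    [/\ m g = 0, b g = 0 & (2 %| sigma g)%Z]].

Lemma groupRS_subgroup : is_subgroup (groupR `&` groupS).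
Proof.
have [[R1 RM RV] _] := groupR_normal; have [[S1 SM SV] _] := groupS_normal.
split=> // [x y [Rx Sx] [Ry Sy]|x [Rx Sx]].
  by split; [apply: RM | apply: SM].
by split; [apply: RV | apply: SV].
Qed.

Lemma even_sigma_subgroup : is_subgroup even_sigma.
Proof.
have [K1 KM KV] := groupRS_subgroup.
split=> // [x y [Kx [mx bx sx]] [Ky [my by_ sy]]|x [Kx [mx bx sx]]].
  split; first exact: KM.
  have [-> -> _ ->] := groupRS_traceM Kx Ky.
  by rewrite mx bx my by_ !mul0r !addr0 rpredD.
split; first exact: KV.
have := groupRS_traceM Kx (KV _ Kx); rewrite mulgV [tr 1%g]run1 /= mx bx.
rewrite !mul0r !addr0 !add0r => -[<- <- _ /esym sV]; split=> //.
by move/eqP: sV; rewrite addrC addr_eq0 => /eqP->; rewrite rpredN.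
Qed.

Lemma groupRS_commg_trace x y :
    (groupR `&` groupS) x -> (groupR `&` groupS) y ->
  [/\ m [~ x, y]%g = 0, b [~ x, y]%g = 0, n [~ x, y]%g = 0 &
      (2 %| tau [~ x, y]%g)%Z /\
      sigma (x * y)%g = sigma (y * x)%g + sigma [~ x, y]%g +
         m (y * x)%g * tau [~ x, y]%g].
Proof.
move=> Kx Ky; have [_ KM _] := groupRS_subgroup.
have Kxy := subgroup_commg groupRS_subgroup Kx Ky.
have := groupRS_traceM (KM _ _ Ky Kx) Kxy; rewrite -commgC.
have [-> -> -> _] := groupRS_traceM Kx Ky.
have [-> -> -> _] := groupRS_traceM Ky Kx => -[mM bM nM ->].
have eq0 (p q r : int) : p + q = q + p + r -> r = 0 by lia.
rewrite (eq0 _ _ _ mM) (eq0 _ _ _ bM) (eq0 _ _ _ nM).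
split=> //; split; last by rewrite mulr0 addr0.
have /derivedR_trace[] // : derived groupR [~ x, y]%g.
by apply: commutator_mem; [case: Kx | case: Ky].
Qed.

(** Comparing sigma at xy and at yx leaves the antisymmetrized correction terms, up to a multiple of
    the even number tau [x, y]. *)
Lemma even_sigma_commg x y : (groupR `&` groupS) x -> (groupR `&` groupS) y ->
    (2 %| m x * tau y - m y * tau x + (b x * n y - b y * n x))%Z ->
  even_sigma [~ x, y]%g.
Proof.
move=> Kx Ky xy2; split; first exact: subgroup_commg groupRS_subgroup Kx Ky.
have [-> -> _ [tau2 sM]] := groupRS_commg_trace Kx Ky; split=> //.
move: sM; have [_ _ _ ->] := groupRS_traceM Kx Ky.
have [_ _ _ ->] := groupRS_traceM Ky Kx => sM.
have -> : sigma [~ x, y]%g = m x * tau y - m y * tau x + (b x * n y - b y * n x)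
    - m (y * x)%g * tau [~ x, y]%g by lia.
by rewrite rpredB // dvdz_mull.
Qed.

(** The form in [even_sigma_commg] is even on each factor: in the first, x has m = b = n = 0 and tau
    even; in the second, both entries have m = 0 and b even; in the third, both have m = b = 0. *)
Lemma fox_denominator_even_sigma :
  fox_denominator groupR groupS `<=` even_sigma.
Proof.
have Rsub := normal_subgroup groupR_normal.
have Ssub := normal_subgroup groupS_normal.
have R'R := derived_sub Rsub; have S'S := derived_sub Ssub.
have Nsub := even_sigma_subgroup.
apply: setprod_sub => //; first apply: setprod_sub => //;
  apply: commutator_sub => // x y.
- move=> [R'x S'x] Ky; apply: even_sigma_commg => //.
    by split; [apply: R'R | apply: S'S].
  have [_ mx nx _ taux] := derivedR_trace R'x.
  have [_ bx tx] := derivedS_trace S'x.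
  (* Both memberships combine: 2 n + t = 0 comes from R', and t = 0 from S'. *)
  have -> : n x = 0 by lia.
  by rewrite mx bx !mul0r mulr0 subrr addr0 add0r rpredN dvdz_mull.
- move=> [R'x Sx] [R'y Sy]; apply: even_sigma_commg.
  + by split=> //; apply: R'R.
  + by split=> //; apply: R'R.
  have [_ -> _ bx _] := derivedR_trace R'x.
  have [_ -> _ by_ _] := derivedR_trace R'y.
  by rewrite !mul0r subrr add0r rpredB // dvdz_mulr.
- move=> [Rx S'x] [Ry S'y]; apply: even_sigma_commg.
  + by split=> //; apply: S'S.
  + by split=> //; apply: S'S.
  have [-> -> _] := derivedS_trace S'x; have [-> -> _] := derivedS_trace S'y.
  by rewrite !mul0r !subrr ?addr0.
Qed.

End Trace.

(** * An element of the numerator outside the denominator *)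

Lemma smallest_subgroup1 (G : groupType) (E : set G) :
  smallest (@is_subgroup G) E 1%g.
Proof. by move=> H [[]]. Qed.

Lemma fox_denominator1 (G : groupType) (R S : set G) : fox_denominator R S 1%g.
Proof.
exists 1%g; last by exists 1%g; [apply: smallest_subgroup1 | rewrite mulg1].
exists 1%g; first exact: smallest_subgroup1.
by exists 1%g; [apply: smallest_subgroup1 | rewrite mulg1].
Qed.

(** With c = [x, y], the two factors on the right are c (c^x)^-1 and c^x c. *)
Lemma sqr_commg (G : groupType) (x y : G) :
  ([~ x, y] * [~ x, y] = [~ [~ x, y]^-1, x] * [~ x * x, y])%g.
Proof. by rewrite /commg /conjg !gnorm. Qed.

Theorem mainTheorem3 :
  exists (F : groupType) (R S : set F),
    [/\ is_free F, is_normal R, is_normal S &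
        nontrivial_quotient (fox_numerator R S) (fox_denominator R S)].
Proof.
have Rn := groupR_normal; have Sn := groupS_normal.
exists (freegroup (option bool)), groupR, groupS.
split=> //; first exact: freegroup_is_free.
pose x := freegroup_gen (None : option bool).
pose y z := freegroup_gen (Some z : option bool).
pose c z := [~ x, y z]%g; pose u z := [~ (c z)^-1, x]%g.
pose w := ([~ c false, u true] * [~ u false, c true] *
           ([~ c false, c true] * [~ c false, c true])^-1)%g.
have Rx : groupR x by [].
have Sy z : groupS (y z) by case: z.
have [_ _ RV] := normal_subgroup Rn; have [_ SM SV] := normal_subgroup Sn.
have Rc z : groupR (c z) by apply: normal_commg.
have Sc z : groupS (c z).
  rewrite -[c z]invgK invgR; apply: (subgroupV (normal_subgroup Sn)).
  exact: normal_commg.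
have Ku z : (derived groupR `&` groupS) (u z).
  split; first by apply: commutator_mem => //; apply: RV.
  by apply: normal_commg => //; apply: SV.
have Kc z : (groupR `&` groupS) (c z) by [].
(* Although [x] is not in S, [x * x] is, its exponent sum in a being even. *)
have S'v z : derived groupS [~ x * x, y z]%g by apply: commutator_mem.
have w_num : fox_numerator groupR groupS w.
  exact: (fox_numerator_commg Rn Sn (Kc _) (Kc _) (Ku _) (Ku _) (S'v _) (S'v _)
    (sqr_commg _ _) (sqr_commg _ _)).
exists (lcoset (fox_denominator groupR groupS) w); first by exists w.
move=> wD.
have /fox_denominator_even_sigma[_ [_ _]] : fox_denominator groupR groupS w.
  by rewrite -wD; exists 1%g; [apply: fox_denominator1 | rewrite mulg1].
(* What remains is that sigma is odd at [w], decided by evaluating this explicit word. *)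
by vm_compute.
Qed.
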